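(* Let $X$ be a tensor 0-representable regular poly-bicategory, and suppose tensor units $1_x: x \to x$ have been chosen for all 0-cells $x$ of $X$. Then there exist witnesses of unitality $\{\tilde{l}_a: (1_x,a) \to (a),\ \tilde{r}_a: (a,1_y) \to (a)\}$, indexed by the 1-cells $a: x \to y$ of $X$, such that the following equations hold: - for all 2-cells $p: (a,\Gamma) \to (b,\Delta)$, $$\mathrm{cut}_{1,2}(p,\tilde{l}_b) = \mathrm{cut}_{1,1}(\tilde{l}_a,p);$$ - for all 2-cells $p': (\Gamma',a) \to (\Delta',b)$ with $n$ inputs and $m$ outputs, $$\mathrm{cut}_{m,1}(p',\tilde{r}_b) = \mathrm{cut}_{1,n}(\tilde{r}_a,p');$$ - for all 2-cells $q: (\Gamma_1,a,b,\Gamma_2)\to(\Delta)$, where the displayed $a$ and $b$ are the $j$-th and $(j+1)$-st inputs of $q$, $$\mathrm{cut}_{1,j}(\tilde{r}_a,q) = \mathrm{cut}_{1,j+1}(\tilde{l}_b,q).$$ Here $\Gamma,\Delta,\Gamma',\Delta',\Gamma_1,\Gamma_2$ are arbitrary, possibly empty, sequences of 1-cells.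
   Context: A regular 2-polygraph $X$ consists of a set of 0-cells, a set of 1-cells $a: x \to y$ (each with a source and a target 0-cell), and, for all $n,m\ge 1$, a set of 2-cells $p:(a_1,\ldots,a_n)\to(b_1,\ldots,b_m)$, whose input $(a_i)$ and output $(b_j)$ are non-empty composable sequences of 1-cells (the target of each is the source of the next) with the same initial source and the same final target; write $\partial_i^-p=a_i$, $\partial_j^+p=b_j$. Greek capitals denote possibly empty composable sequences of 1-cells, and commas denote concatenation. A (non-unital) regular poly-bicategory is a regular 2-polygraph with operations $\mathrm{cut}_{j,i}$: given $t:(\Gamma)\to(\Delta_1,a,\Delta_2)$ and $s:(\Gamma_1,a,\Gamma_2)\to(\Delta)$, where the displayed $a$ is the $j$-th output of $t$ and the $i$-th input of $s$, such that ($\Gamma_1$ or $\Delta_1$ is empty) and ($\Gamma_2$ or $\Delta_2$ is empty), there is a composite 2-cell $\mathrm{cut}_{j,i}(t,s):(\Gamma_1,\Gamma,\Gamma_2)\to(\Delta_1,\Delta,\Delta_2)$. These satisfy associativity and interchange: whenever three 2-cells can be composed by two cuts, along the same two identified 1-cells, in two different orders, the two results are equal (e.g. $\mathrm{cut}_{j,1}(t,\mathrm{cut}_{i,1}(s,r))=\mathrm{cut}_{i+j-1,1}(\mathrm{cut}_{j,1}(t,s),r)$). No unit cells are part of the structure. Universality. A 2-cell $t:(\Gamma)\to(\Delta_1,a,\Delta_2)$, with $a$ in $j$-th position, is universal at $\partial_j^+$ if for all $\Gamma_1,\Gamma_2$ and non-empty $\Delta$ with ($\Gamma_1$ or $\Delta_1$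 empty) and ($\Gamma_2$ or $\Delta_2$ empty), every 2-cell $s:(\Gamma_1,\Gamma,\Gamma_2)\to(\Delta_1,\Delta,\Delta_2)$ equals $\mathrm{cut}(t,r)$, composed along $a$, for a unique $r:(\Gamma_1,a,\Gamma_2)\to(\Delta)$. Dually, $t:(\Gamma_1,a,\Gamma_2)\to(\Delta)$, with $a$ in $i$-th position, is universal at $\partial_i^-$ if for all $\Delta_1,\Delta_2$ and non-empty $\Gamma$ with ($\Gamma_1$ or $\Delta_1$ empty) and ($\Gamma_2$ or $\Delta_2$ empty), every $s:(\Gamma_1,\Gamma,\Gamma_2)\to(\Delta_1,\Delta,\Delta_2)$ equals $\mathrm{cut}(r,t)$, composed along $a$, for a unique $r:(\Gamma)\to(\Delta_1,a,\Delta_2)$. A unit on a 1-cell $a$ is a 2-cell $\mathrm{id}_a:(a)\to(a)$ such that every cut with $\mathrm{id}_a$, on either side, returns the other 2-cell. $X$ is unital if every 1-cell has a unit. A 1-cell $1_x: x\to x$ is a tensor unit on the 0-cell $x$ if for each 1-cell $a: x\to y$ there is a 2-cell $l_a:(1_x,a)\to(a)$ universal at both $\partial_1^+$ and $\partial_2^-$, and for each 1-cell $b:z\to x$ there is a 2-cell $r_b:(b,1_x)\to(b)$ universal at both $\partial_1^+$ and $\partial_1^-$; 2-cells with these boundaries and universal properties are called witnesses of unitality. $X$ is tensor 0-representable if it is unital and there exists a tensor unit on each 0-cell. *)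

(* Defs.v *)
From mathcomp Require Import all_boot.

Set Implicit Arguments.
Unset Strict Implicit.
Unset Printing Implicit Defensive.

Fixpoint is_path (C0 C1 : Type) (src tgt : C1 -> C0)
    (x : C0) (s : seq C1) (y : C0) : Prop :=
  match s with
  | [::] => x = y
  | a :: s' => src a = x /\ is_path src tgt (tgt a) s' y
  end.

(* The 2-cells of all shapes form one type, fibred over their boundaries, so
   that equations between composites are plain equalities. *)
Record polygraph := Polygraph {
  cell0 : Type;
  cell1 : Type;
  cell2 : Type;
  src : cell1 -> cell0;
  tgt : cell1 -> cell0;
  inp : cell2 -> seq cell1;
  out : cell2 -> seq cell1;
  inp_neq0 : forall p, inp p <> [::];
  out_neq0 : forall p, out p <> [::];
  boundaryP : forall p, exists x y,
    is_path src tgt x (inp p) y /\ is_path src tgt x (out p) y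
}.

(* Positions are counted from 1. *)
Definition at_pos (T : Type) (s : seq T) (k : nat)
    (s1 : seq T) (a : T) (s2 : seq T) : Prop :=
  s = s1 ++ a :: s2 /\ k = (size s1).+1.

Definition planar (T : Type) (G1 G2 D1 D2 : seq T) : Prop :=
  (G1 = [::] \/ D1 = [::]) /\ (G2 = [::] \/ D2 = [::]).

Definition cuttable (X : polygraph) (j i : nat) (t s : cell2 X) : Prop :=
  exists D1 a D2 G1 G2,
    [/\ at_pos (out t) j D1 a D2, at_pos (inp s) i G1 a G2
      & planar G1 G2 D1 D2].

(* [cut] is a partial operation, with domain [cuttable]; it is represented by
   a total function whose values outside [cuttable] are unconstrained and
   never used. *)
Record polybicat := PolyBicat {
  pg :> polygraph;
  cut : nat -> nat -> cell2 pg -> cell2 pg -> cell2 pg;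
  cut_boundary : forall j i (t s : cell2 pg) D1 a D2 G1 G2,
    at_pos (out t) j D1 a D2 -> at_pos (inp s) i G1 a G2 ->
    planar G1 G2 D1 D2 ->
    inp (cut j i t s) = G1 ++ inp t ++ G2 /\
    out (cut j i t s) = D1 ++ out s ++ D2;
  (* Two cuts of three 2-cells glue them along a tree, which is a chain, or
     two 2-cells plugged into two inputs of a third, or two 2-cells plugged
     into two outputs of a third. *)
  cut_assoc : forall j1 i1 j2 i2 (t s r : cell2 pg),
    cuttable j1 i1 t s ->
    cuttable (j1 + j2).-1 i2 (cut j1 i1 t s) r ->
    cuttable j2 i2 s r ->
    cuttable j1 (i1 + i2).-1 t (cut j2 i2 s r) ->
    cut j1 (i1 + i2).-1 t (cut j2 i2 s r) =
    cut (j1 + j2).-1 i2 (cut j1 i1 t s) r;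
  cut_interchange_inp : forall j1 i1 j2 i2 (t1 t2 s : cell2 pg),
    i1 < i2 ->
    cuttable j2 i2 t2 s ->
    cuttable j1 i1 t1 (cut j2 i2 t2 s) ->
    cuttable j1 i1 t1 s ->
    cuttable j2 (i2 + size (inp t1)).-1 t2 (cut j1 i1 t1 s) ->
    cut j1 i1 t1 (cut j2 i2 t2 s) =
    cut j2 (i2 + size (inp t1)).-1 t2 (cut j1 i1 t1 s);
  cut_interchange_out : forall j1 i1 j2 i2 (t s1 s2 : cell2 pg),
    j1 < j2 ->
    cuttable j2 i2 t s2 ->
    cuttable j1 i1 (cut j2 i2 t s2) s1 ->
    cuttable j1 i1 t s1 ->
    cuttable (j2 + size (out s1)).-1 i2 (cut j1 i1 t s1) s2 ->
    cut j1 i1 (cut j2 i2 t s2) s1 =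
    cut (j2 + size (out s1)).-1 i2 (cut j1 i1 t s1) s2
}.

Definition universal_out (X : polybicat) (j : nat) (t : cell2 X) : Prop :=
  exists D1 a D2, at_pos (out t) j D1 a D2 /\
    forall G1 G2 D, D <> [::] -> planar G1 G2 D1 D2 ->
    forall s : cell2 X,
      inp s = G1 ++ inp t ++ G2 -> out s = D1 ++ D ++ D2 ->
      exists! r : cell2 X,
        [/\ inp r = G1 ++ a :: G2, out r = D & s = cut j (size G1).+1 t r].

Definition universal_inp (X : polybicat) (i : nat) (t : cell2 X) : Prop :=
  exists G1 a G2, at_pos (inp t) i G1 a G2 /\
    forall D1 D2 G, G <> [::] -> planar G1 G2 D1 D2 ->
    forall s : cell2 X,
      inp s = G1 ++ G ++ G2 -> out s = D1 ++ out t ++ D2 ->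
      exists! r : cell2 X,
        [/\ inp r = G, out r = D1 ++ a :: D2 & s = cut (size D1).+1 i r t].

Definition is_unit (X : polybicat) (a : cell1 X) (e : cell2 X) : Prop :=
  [/\ inp e = [:: a], out e = [:: a],
      forall j (t : cell2 X), cuttable j 1 t e -> cut j 1 t e = t
    & forall i (s : cell2 X), cuttable 1 i e s -> cut 1 i e s = s].

Definition unital (X : polybicat) : Prop :=
  forall a : cell1 X, exists e, is_unit a e.

Definition left_witness (X : polybicat) (u a : cell1 X) (l : cell2 X) : Prop :=
  [/\ inp l = [:: u; a], out l = [:: a], universal_out 1 l
    & universal_inp 2 l].

Definition right_witness (X : polybicat) (u b : cell1 X) (r : cell2 X) : Prop :=
  [/\ inp r = [:: b; u], out r = [:: b], universal_out 1 r
    & universal_inp 1 r].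

Definition tensor_unit (X : polybicat) (x : cell0 X) (u : cell1 X) : Prop :=
  [/\ src u = x, tgt u = x,
      forall a : cell1 X, src a = x -> exists l, left_witness u a l
    & forall b : cell1 X, tgt b = x -> exists r, right_witness u b r].

Definition tensor_0_representable (X : polybicat) : Prop :=
  unital X /\ forall x : cell0 X, exists u, tensor_unit x u.

(* Main.v *)
Require Import Defs.
From mathcomp Require Import all_boot.
From mathcomp Require Import zify.
From Stdlib Require Import IndefiniteDescription.

Set Implicit Arguments.
Unset Strict Implicit.
Unset Printing Implicit Defensive.

(** Write a 2-cell with one output as an operation, so that a witness [l] on [a]
    is [l(u, a)] with [u] the tensor unit, and cuts are substitutions.  The
    difficulty is that witnesses on different 1-cells are unrelated choices.
    The remedy is the one of Saavedra and Kock for units of monoidal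
    categories: a single multiplication [e : (u, u) -> (u)], universal at its
    output, is fixed on each unit, and every witness is corrected by an
    invertible unary cell so that [u] acts on [a] through [e]:
      [l(u, l(v, a)) = l(e(u, v), a)] and [r(r(a, u), v) = r(a, e(u, v))].
    This is [associative_witness], where left and right are treated together.
    The same [e] is used on both sides of a unit.  The three equations then
    follow from cancellation alone.

    Naturality ([natural_witness]): for [p : (a, H) -> (b, D)], universality of
    [l_a] at its output gives [l_b(u, p(a, H)) = s(l_a(u, a), H)] for some [s].
    Plugging [e] into [u] and using the action law on both sides,
    [l_b(u, l_b(v, p)) = s(l_a(u, l_a(v, a)), H) = l_b(u, p(l_a(v, a), H))], and
    [l_b] can be cancelled, being universal at its second input.

    Compatibility in the middle ([triangle]): universality of [l_b] at its
    output gives [q(r_a(a, u), b) = T(a, l_b(u, b))] for some [T].  Plugging [e]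
    into [u],
    [q(r_a(r_a(a, u), v), b) = q(r_a(a, e(u, v)), b) = T(a, l_b(e(u, v), b))
       = T(a, l_b(u, l_b(v, b))) = q(r_a(a, u), l_b(v, b))],
    and [r_a(a, u)] can be cancelled, being universal at its output. *)

(** * Cuts along displayed 1-cells *)

Lemma cat_eq_nil (T : Type) (s1 s2 : seq T) :
  s1 ++ s2 = [::] <-> s1 = [::] /\ s2 = [::].
Proof. by split=> [|[-> ->]]; case: s1 => [|? ?]; case: s2. Qed.

Lemma cons_eq_nil (T : Type) (x : T) (s : seq T) : x :: s = [::] <-> False.
Proof. by []. Qed.

Ltac solve_planar :=
  repeat match goal with H : planar _ _ _ _ |- _ => move: H end;
  rewrite /planar ?cat_eq_nil ?cons_eq_nil; tauto.

Lemma at_pos_inj (T : Type) k (s : seq T) s1 a s2 s1' a' s2' :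
  at_pos s k s1 a s2 -> at_pos s k s1' a' s2' -> [/\ s1 = s1', a = a' & s2 = s2'].
Proof.
move=> [-> ->] [+ [esz]].
elim: s1 s1' esz => [|x s1 IH] [|y s1'] //=; first by move=> _ [-> ->].
by move=> [/IH{}IH] [-> /IH[-> -> ->]].
Qed.

Section Cuts.

Variable X : polybicat.
Implicit Types (a b c : cell1 X) (t s r w f p q : cell2 X).

Lemma cuttableI D1 a D2 G1 G2 j i t s :
  out t = D1 ++ a :: D2 -> inp s = G1 ++ a :: G2 -> planar G1 G2 D1 D2 ->
  j = (size D1).+1 -> i = (size G1).+1 -> cuttable j i t s.
Proof. by move=> ? ? ? -> ->; exists D1, a, D2, G1, G2. Qed.

Lemma inp_cut D1 a D2 G1 G2 j i t s :
  out t = D1 ++ a :: D2 -> inp s = G1 ++ a :: G2 -> planar G1 G2 D1 D2 ->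
  j = (size D1).+1 -> i = (size G1).+1 ->
  inp (cut j i t s) = G1 ++ inp t ++ G2.
Proof.
move=> ot is_ pl ej ei.
by have [] := cut_boundary (conj ot ej) (conj is_ ei) pl.
Qed.

Lemma out_cut D1 a D2 G1 G2 j i t s :
  out t = D1 ++ a :: D2 -> inp s = G1 ++ a :: G2 -> planar G1 G2 D1 D2 ->
  j = (size D1).+1 -> i = (size G1).+1 ->
  out (cut j i t s) = D1 ++ out s ++ D2.
Proof.
move=> ot is_ pl ej ei.
by have [] := cut_boundary (conj ot ej) (conj is_ ei) pl.
Qed.

Lemma inp_cut1 a G1 G2 i t s :
  out t = [:: a] -> inp s = G1 ++ a :: G2 -> i = (size G1).+1 ->
  inp (cut 1 i t s) = G1 ++ inp t ++ G2.
Proof. by move=> ot is_ ei; apply: (@inp_cut [::] a [::]) => //; solve_planar. Qed.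

Lemma out_cut1 a G1 G2 i t s :
  out t = [:: a] -> inp s = G1 ++ a :: G2 -> i = (size G1).+1 ->
  out (cut 1 i t s) = out s.
Proof.
move=> ot is_ ei; rewrite (@out_cut [::] a [::] G1 G2) ?cats0 //.
by solve_planar.
Qed.

(** Associativity with positions read off from the displayed decompositions.
    The two planarity conditions are those of the bracketing
    [cut (cut t s) r]; they imply those of the other bracketing. *)
Lemma cutA D1 a D2 G1 G2 K1 b K2 H1 H2 j1 i1 j2 i2 j i t s r :
  out t = D1 ++ a :: D2 -> inp s = G1 ++ a :: G2 ->
  out s = K1 ++ b :: K2 -> inp r = H1 ++ b :: H2 ->
  planar G1 G2 D1 D2 -> planar H1 H2 (D1 ++ K1) (K2 ++ D2) ->
  j1 = (size D1).+1 -> i1 = (size G1).+1 ->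
  j2 = (size K1).+1 -> i2 = (size H1).+1 ->
  j = (size (D1 ++ K1)).+1 -> i = (size (H1 ++ G1)).+1 ->
  cut j1 i t (cut j2 i2 s r) = cut j i2 (cut j1 i1 t s) r.
Proof.
move=> ot is_ os ir pl1 pl2 ej1 ei1 ej2 ei2 ej ei.
have pl3 : planar H1 H2 K1 K2 by solve_planar.
have -> : j = (j1 + j2).-1 by rewrite ej size_cat; lia.
have -> : i = (i1 + i2).-1 by rewrite ei size_cat; lia.
apply: cut_assoc.
- exact: cuttableI ot is_ pl1 _ _.
- apply: (@cuttableI (D1 ++ K1) b (K2 ++ D2) H1 H2) => //.
    by rewrite (out_cut ot is_) // os -!catA.
  by rewrite size_cat; lia.
- exact: cuttableI os ir pl3 _ _.
- apply: (@cuttableI D1 a D2 (H1 ++ G1) (G2 ++ H2)) => //.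
  + by rewrite (inp_cut os ir) // is_ -!catA.
  + by solve_planar.
  by rewrite size_cat; lia.
Qed.

(** Interchange for cells plugged into two inputs of [s].  Each [t] sees the
    other input of [s] in its context, so the planarity conditions already
    force [A2] and [B1] to be empty; this is why they survive the first cut. *)
Lemma cutC A1 a A2 B1 b B2 G1 G2 G3 j1 i1 j2 i2 i t1 t2 s :
  out t1 = A1 ++ a :: A2 -> out t2 = B1 ++ b :: B2 ->
  inp s = G1 ++ a :: G2 ++ b :: G3 ->
  planar G1 (G2 ++ b :: G3) A1 A2 -> planar (G1 ++ a :: G2) G3 B1 B2 ->
  j1 = (size A1).+1 -> i1 = (size G1).+1 ->
  j2 = (size B1).+1 -> i2 = (size (G1 ++ a :: G2)).+1 ->
  i = (size (G1 ++ inp t1 ++ G2)).+1 ->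
  cut j1 i1 t1 (cut j2 i2 t2 s) = cut j2 i t2 (cut j1 i1 t1 s).
Proof.
move=> ot1 ot2 is_ pl1 pl2 ej1 ei1 ej2 ei2 ei.
have is' : inp s = (G1 ++ a :: G2) ++ b :: G3 by rewrite is_ -catA.
have ei2' : i2 = (size G1 + size G2).+2 by rewrite ei2 size_cat /= addnS.
have -> : i = (i2 + size (inp t1)).-1 by rewrite ei ei2' !size_cat; lia.
apply: cut_interchange_inp.
- by lia.
- exact: cuttableI ot2 is' pl2 _ _.
- apply: (@cuttableI A1 a A2 G1 (G2 ++ inp t2 ++ G3)) => //.
    by rewrite (inp_cut ot2 is') // -!catA.
  by solve_planar.
- exact: cuttableI ot1 is_ pl1 _ _.
- apply: (@cuttableI B1 b B2 (G1 ++ inp t1 ++ G2) G3) => //.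
  + by rewrite (inp_cut ot1 is_) // -!catA.
  + by solve_planar.
  by rewrite ei2' !size_cat; lia.
Qed.

(** * Universal 2-cells *)

(** For a cell with a single output the planarity condition in
    [universal_out] is void, and every cell is an admissible target for the
    factorization because its output is never empty. *)
Lemma universal_out1I a t :
  out t = [:: a] ->
  (forall G1 G2 s, inp s = G1 ++ inp t ++ G2 ->
     exists r, [/\ inp r = G1 ++ a :: G2, out r = out s
                  & s = cut 1 (size G1).+1 t r]) ->
  (forall G1 G2 r1 r2, inp r1 = G1 ++ a :: G2 -> inp r2 = G1 ++ a :: G2 ->
     out r1 = out r2 ->
     cut 1 (size G1).+1 t r1 = cut 1 (size G1).+1 t r2 -> r1 = r2) ->
  universal_out 1 t.
Proof.
move=> ot ex inj; exists [::], a, [::]; split=> [//|G1 G2 D _ _ s is_ os].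
have [r [ir or_ es]] := ex _ _ _ is_.
have or' : out r = D by rewrite or_ os /= cats0.
exists r; split=> // r' [ir' or'' es'].
by apply: (inj G1 G2) => //; [rewrite or' or'' | rewrite -es -es'].
Qed.

Lemma universal_out1_ex a G1 G2 i t s :
  universal_out 1 t -> out t = [:: a] ->
  inp s = G1 ++ inp t ++ G2 -> i = (size G1).+1 ->
  exists r, [/\ inp r = G1 ++ a :: G2, out r = out s & s = cut 1 i t r].
Proof.
move=> [D1 [a' [D2 [pos U]]]] ot is_ ->.
have [e1 e2 e3] := at_pos_inj (conj ot erefl : at_pos _ 1 [::] a [::]) pos; subst.
have [||r [ex _]] := U G1 G2 (out s) (@out_neq0 _ s) _ _ is_ _.
- by solve_planar.
- by rewrite cats0.
by exists r.
Qed.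

Lemma universal_out1_inj a G1 G2 i t r1 r2 :
  universal_out 1 t -> out t = [:: a] ->
  inp r1 = G1 ++ a :: G2 -> inp r2 = G1 ++ a :: G2 -> out r1 = out r2 ->
  i = (size G1).+1 -> cut 1 i t r1 = cut 1 i t r2 -> r1 = r2.
Proof.
move=> [D1 [a' [D2 [pos U]]]] ot ir1 ir2 or_ ei ec.
have [e1 e2 e3] := at_pos_inj (conj ot erefl : at_pos _ 1 [::] a [::]) pos; subst.
have [|||r [_ un]] := U G1 G2 (out r1) (@out_neq0 _ r1) _ (cut 1 (size G1).+1 t r1).
- by solve_planar.
- exact: inp_cut1 ot ir1 _.
- by rewrite (out_cut1 ot ir1) // cats0.
by rewrite -(un r1) // -(un r2).
Qed.

Lemma universal_inp1I a c G1 G2 k w :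
  inp w = G1 ++ a :: G2 -> out w = [:: c] -> k = (size G1).+1 ->
  (forall D1 D2 H s, H <> [::] -> planar G1 G2 D1 D2 ->
     inp s = G1 ++ H ++ G2 -> out s = D1 ++ c :: D2 ->
     exists r, [/\ inp r = H, out r = D1 ++ a :: D2
                  & s = cut (size D1).+1 k r w]) ->
  (forall D1 D2 r1 r2, planar G1 G2 D1 D2 -> inp r1 = inp r2 ->
     out r1 = D1 ++ a :: D2 -> out r2 = D1 ++ a :: D2 ->
     cut (size D1).+1 k r1 w = cut (size D1).+1 k r2 w -> r1 = r2) ->
  universal_inp k w.
Proof.
move=> iw ow ek ex inj; exists G1, a, G2; split=> [//|D1 D2 G G0 pl s is_ os].
rewrite ow /= in os.
have [r [ir or_ es]] := ex _ _ _ _ G0 pl is_ os.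
exists r; split=> // r' [ir' or' es'].
by apply: (inj D1 D2) => //; [rewrite ir ir' | rewrite -es -es'].
Qed.

Lemma universal_inp1_ex a c G1 G2 H D1 D2 j k w s :
  universal_inp k w -> inp w = G1 ++ a :: G2 -> out w = [:: c] ->
  k = (size G1).+1 -> H <> [::] -> planar G1 G2 D1 D2 ->
  inp s = G1 ++ H ++ G2 -> out s = D1 ++ c :: D2 -> j = (size D1).+1 ->
  exists r, [/\ inp r = H, out r = D1 ++ a :: D2 & s = cut j k r w].
Proof.
move=> [G1' [a' [G2' [pos U]]]] iw ow ek H0 pl is_ os ->.
have [e1 e2 e3] := at_pos_inj (conj iw ek) pos; subst G1' a' G2'.
have [|r [ex _]] := U D1 D2 H H0 pl s is_; first by rewrite ow.
by exists r.
Qed.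

Lemma universal_inp1_inj a c G1 G2 D1 D2 j k w r1 r2 :
  universal_inp k w -> inp w = G1 ++ a :: G2 -> out w = [:: c] ->
  k = (size G1).+1 -> planar G1 G2 D1 D2 -> inp r1 = inp r2 ->
  out r1 = D1 ++ a :: D2 -> out r2 = D1 ++ a :: D2 -> j = (size D1).+1 ->
  cut j k r1 w = cut j k r2 w -> r1 = r2.
Proof.
move=> [G1' [a' [G2' [pos U]]]] iw ow ek pl ir or1 or2 ej ec.
have [e1 e2 e3] := at_pos_inj (conj iw ek) pos; subst G1' a' G2' j.
have [||r [_ un]] :=
  U D1 D2 (inp r1) (@inp_neq0 _ r1) pl (cut (size D1).+1 k r1 w).
- exact: inp_cut or1 iw pl _ _.
- exact: out_cut or1 iw pl _ _.
by rewrite -(un r1) // -(un r2).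
Qed.

(** Factoring through [cut 1 i t s] is factoring through [t], then [s]. *)
Lemma universal_out1_cut b c H1 H2 i t s :
  universal_out 1 t -> out t = [:: c] ->
  universal_out 1 s -> out s = [:: b] ->
  inp s = H1 ++ c :: H2 -> i = (size H1).+1 ->
  universal_out 1 (cut 1 i t s).
Proof.
move=> ut ot us os is_ ei.
have ics := inp_cut1 ot is_ ei.
have ocs : out (cut 1 i t s) = [:: b] by rewrite (out_cut1 ot is_ ei).
have comp G1 G2 r : inp r = G1 ++ b :: G2 ->
    cut 1 (size G1).+1 (cut 1 i t s) r =
    cut 1 (size (G1 ++ H1)).+1 t (cut 1 (size G1).+1 s r).
  by move=> ir; symmetry; apply: (cutA (D1:=[::]) (K1:=[::]) ot is_ os ir) => //;
     solve_planar.
apply: (universal_out1I ocs) => [G1 G2 r ir|G1 G2 r1 r2 ir1 ir2 or_ ec].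
- have [|r0 [ir0 or0 er]] :=
    universal_out1_ex (G1:=G1 ++ H1) (G2:=H2 ++ G2) ut ot _ erefl (s:=r).
    by rewrite ir ics -!catA.
  have [|r1 [ir1 or1 er0]] :=
    universal_out1_ex (G1:=G1) (G2:=G2) us os _ erefl (s:=r0).
    by rewrite ir0 is_ -!catA.
  exists r1; split=> //; first by rewrite or1.
  by rewrite (comp G1 G2) // -er0 -er.
- apply: (universal_out1_inj us os ir1 ir2 or_ erefl).
  have icr r : inp r = G1 ++ b :: G2 ->
      inp (cut 1 (size G1).+1 s r) = (G1 ++ H1) ++ c :: H2 ++ G2.
    by move=> ir; rewrite (inp_cut1 os ir) // is_ -!catA.
  apply: (universal_out1_inj ut ot (icr _ ir1) (icr _ ir2) _ erefl).
    by rewrite (out_cut1 os ir1) // (out_cut1 os ir2).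
  by rewrite -(comp _ _ _ ir1) -(comp _ _ _ ir2).
Qed.

(** * Invertible unary cells *)

Definition inverse_cells a f f' :=
  [/\ inp f = [:: a], out f = [:: a], inp f' = [:: a], out f' = [:: a]
    & is_unit a (cut 1 1 f f') /\ is_unit a (cut 1 1 f' f)].

Lemma inverse_cells_out1 a f f' : inverse_cells a f f' -> universal_out 1 f.
Proof.
move=> [if_ of_ if' of' [un1 un2]].
have K g g' G1 G2 r : out g = [:: a] -> inp g = [:: a] -> inp g' = [:: a] ->
    out g' = [:: a] ->
    is_unit a (cut 1 1 g g') -> inp r = G1 ++ a :: G2 ->
    cut 1 (size G1).+1 g (cut 1 (size G1).+1 g' r) = r.
  move=> og ig ig' og' [_ ou _ un] ir.
  rewrite (cutA (D1:=[::]) (G1:=[::]) (K1:=[::]) (i1:=1) (j:=1) og ig' og' ir)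
    ?cats0 //; try solve_planar.
  by apply: un; apply: (cuttableI (D1:=[::]) ou ir) => //; solve_planar.
apply: (universal_out1I of_) => [G1 G2 s|G1 G2 r1 r2 ir1 ir2 _ ec].
- rewrite if_ /= => is_.
  exists (cut 1 (size G1).+1 f' s); split.
  + by rewrite (inp_cut1 of' is_) // if'.
  + by rewrite (out_cut1 of' is_).
  by rewrite (K _ _ G1 G2).
- by rewrite -(K f' f G1 G2 r1) // ec (K f' f G1 G2).
Qed.

Lemma universal_inp1_cut_inverse a G1 G2 k w f f' :
  inp w = G1 ++ a :: G2 -> out w = [:: a] -> k = (size G1).+1 ->
  universal_inp k w -> inverse_cells a f f' ->
  universal_inp k (cut 1 1 w f).
Proof.
move=> iw ow ek uw [if_ of_ if' of' [un1 un2]].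
have icw : inp (cut 1 1 w f) = G1 ++ a :: G2.
  by rewrite (inp_cut1 (G1:=[::]) ow if_) // cats0.
have ocw : out (cut 1 1 w f) = [:: a] by rewrite (out_cut1 (G1:=[::]) ow if_).
have post D1 D2 r : planar G1 G2 D1 D2 -> out r = D1 ++ a :: D2 ->
    cut (size D1).+1 k r (cut 1 1 w f) =
    cut (size D1).+1 1 (cut (size D1).+1 k r w) f.
  move=> pl or_.
  by apply: (cutA (K1:=[::]) (H1:=[::]) or_ iw ow if_); rewrite ?cats0 //; solve_planar.
have K D1 D2 g g' s : inp g = [:: a] -> out g = [:: a] -> inp g' = [:: a] ->
    is_unit a (cut 1 1 g g') -> out s = D1 ++ a :: D2 ->
    cut (size D1).+1 1 (cut (size D1).+1 1 s g) g' = s.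
  move=> ig og ig' [iu _ un _] os.
  rewrite -(cutA (G1:=[::]) (K1:=[::]) (H1:=[::]) (j1:=(size D1).+1) (i:=1) (j2:=1)
    os ig og ig');
    rewrite ?cats0 //; try solve_planar.
  by apply: un; apply: (cuttableI (G1:=[::]) os iu) => //; solve_planar.
apply: (universal_inp1I icw ocw ek) => [D1 D2 H s H0 pl is_ os|].
- have plD : planar [::] [::] D1 D2 by solve_planar.
  have [||r [ir or_ er]] :=
    universal_inp1_ex (s:=cut (size D1).+1 1 s f') uw iw ow ek H0 pl _ _ erefl.
  + by rewrite (inp_cut (G1:=[::]) os if') //= cats0.
  + by rewrite (out_cut (G1:=[::]) os if') // of'.
  exists r; split=> //; rewrite (post D1 D2) // -er.
  by rewrite (K D1 D2).
- move=> D1 D2 r1 r2 pl ir or1 or2; rewrite !(post D1 D2) // => ec.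
  apply: (universal_inp1_inj uw iw ow ek pl ir or1 or2 erefl).
  have oc r : out r = D1 ++ a :: D2 -> out (cut (size D1).+1 k r w) = D1 ++ a :: D2.
    by move=> or_; rewrite (out_cut or_ iw pl) // ow.
  by rewrite -(K D1 D2 f f' (cut _ k r1 w)) ?oc // ec (K D1 D2) ?oc.
Qed.

(** * Witnesses on which the tensor unit acts associatively *)

(** Here [u] occupies position [k'] of [w] and [a] position [k]; left witnesses
    have [k' = 1] and [k = 2], right ones the opposite.  In the notation for
    left witnesses, the composites
    [W = w(u, w(v, a))] and [E = w(e(u, v), a)] have the same boundary, ensured
    by the last hypothesis, and are both universal at their output, so they
    differ by an invertible [g], [E = g(W)].  Since [w] is universal at [a],
    the map [f |-> w(u, f(a))] identifies unary cells [f] on [a] with unary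
    cells after [w]; hence [w(u, f(a)) = g(w(u, a))] for a unique, again
    invertible, [f].  Then [w' = f(w)] satisfies [w(u, w'(v, a)) = E], and
    applying [f] to both sides gives the equation for [w']. *)
Lemma associative_witness (hX : unital X) a u G1 G2 H1 H2 k k' w e :
  inp w = G1 ++ a :: G2 -> inp w = H1 ++ u :: H2 -> out w = [:: a] ->
  k = (size G1).+1 -> k' = (size H1).+1 ->
  universal_out 1 w -> universal_inp k w ->
  inp e = [:: u; u] -> out e = [:: u] -> universal_out 1 e ->
  H1 ++ [:: u; u] ++ H2 = G1 ++ (G1 ++ a :: G2) ++ G2 ->
  exists w', [/\ inp w' = inp w, out w' = [:: a],
    universal_out 1 w' /\ universal_inp k w'
    & cut 1 k w' w' = cut 1 k' e w'].
Proof.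
move=> iw iwu ow ek ek' uw vw ie oe ue eb.
have [id1 id1P] := hX a; have [id_i id_o id_r id_l] := id1P.
pose W := cut 1 k w w; pose E := cut 1 k' e w.
have iW : inp W = G1 ++ (G1 ++ a :: G2) ++ G2 by rewrite (inp_cut1 ow iw) // -iw.
have oW : out W = [:: a] by rewrite (out_cut1 ow iw).
have iE : inp E = G1 ++ (G1 ++ a :: G2) ++ G2 by rewrite (inp_cut1 oe iwu) // ie.
have oE : out E = [:: a] by rewrite (out_cut1 oe iwu).
have uW : universal_out 1 W by exact: (universal_out1_cut uw ow uw ow iw ek).
have uE : universal_out 1 E by exact: (universal_out1_cut ue oe uw ow iwu ek').
have unary t s : out t = [:: a] -> out s = [:: a] -> inp s = inp t ->
    universal_out 1 t ->
    exists g, [/\ inp g = [:: a], out g = [:: a] & s = cut 1 1 t g].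
  move=> ot os its ut.
  have [|g [ig og eg]] := universal_out1_ex (G1:=[::]) (G2:=[::]) (s:=s) ut ot _ erefl.
    by rewrite cats0.
  by exists g; rewrite og.
have icut11 f g : inp f = [:: a] -> out f = [:: a] -> inp g = [:: a] ->
    inp (cut 1 1 f g) = [:: a].
  by move=> if_ of_ ig; rewrite (inp_cut1 (G1:=[::]) of_ ig) // if_.
have ocut11 f g : out f = [:: a] -> inp g = [:: a] -> out g = [:: a] ->
    out (cut 1 1 f g) = [:: a].
  by move=> of_ ig og; rewrite (out_cut1 (G1:=[::]) of_ ig).
have A11 t f g : out t = [:: a] -> inp f = [:: a] -> out f = [:: a] ->
    inp g = [:: a] -> cut 1 1 t (cut 1 1 f g) = cut 1 1 (cut 1 1 t f) g.
  move=> ot if_ of_ ig.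
  by apply: (cutA (D1:=[::]) (G1:=[::]) (K1:=[::]) (H1:=[::]) ot if_ of_ ig) => //;
     solve_planar.
have epi t f g : universal_out 1 t -> out t = [:: a] -> inp f = [:: a] ->
    out f = [:: a] -> inp g = [:: a] -> out g = [:: a] ->
    cut 1 1 t f = cut 1 1 t g -> f = g.
  move=> ut ot if_ of_ ig og.
  by apply: (universal_out1_inj (G1:=[::]) ut ot if_ ig) => //; rewrite of_.
have unit_r t : out t = [:: a] -> cut 1 1 t id1 = t.
  by move=> ot; apply: id_r; apply: (cuttableI (D1:=[::]) (G1:=[::]) ot id_i) => //;
     solve_planar.
have slide f g : inp f = [:: a] -> out f = [:: a] -> inp g = [:: a] ->
    cut 1 k f (cut 1 1 w g) = cut 1 1 (cut 1 k f w) g.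
  move=> if_ of_ ig.
  by apply: (cutA (D1:=[::]) (K1:=[::]) (H1:=[::]) of_ iw ow ig) => //; solve_planar.
have slide2 f g : inp f = [:: a] -> out f = [:: a] -> inp g = [:: a] ->
    out g = [:: a] -> cut 1 k f (cut 1 k g w) = cut 1 k (cut 1 1 f g) w.
  move=> if_ of_ ig og.
  by apply: (cutA (D1:=[::]) (G1:=[::]) (K1:=[::]) of_ ig og iw) => //;
     rewrite ?cats0 //; solve_planar.
(* Passage from unary cells after [w] to unary cells before it. *)
have lift g : inp g = [:: a] -> out g = [:: a] ->
    exists f, [/\ inp f = [:: a], out f = [:: a] & cut 1 k f w = cut 1 1 w g].
  move=> ig og.
  have [||||f [if_ of_ ef]] := universal_inp1_ex (s:=cut 1 1 w g) (H:=[:: a])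
    (D1:=[::]) (D2:=[::]) vw iw ow ek _ _ _ _ erefl => //.
  - by solve_planar.
  - by rewrite (inp_cut1 (G1:=[::]) ow ig) // cats0.
  - by rewrite (out_cut1 (G1:=[::]) ow ig).
  by exists f.
have mono f g : inp f = [:: a] -> out f = [:: a] -> inp g = [:: a] ->
    out g = [:: a] -> cut 1 k f w = cut 1 k g w -> f = g.
  move=> if_ of_ ig og.
  apply: (universal_inp1_inj (D1:=[::]) (D2:=[::]) vw iw ow) => //.
    by solve_planar.
  by rewrite if_.
have unit_k : cut 1 k id1 w = w.
  by apply: id_l; apply: (cuttableI (D1:=[::]) id_o iw) => //; solve_planar.
(* [g] is invertible because [W] and [E] each factor through the other. *)
have [||//||g [ig og eg]] := unary W E; rewrite ?iE //.
have [||//||g' [ig' og' eg']] := unary E W; rewrite ?iE //.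
have gg' : cut 1 1 g g' = id1.
  by apply: (epi W); rewrite ?icut11 ?ocut11 // A11 // -eg -eg' unit_r.
have g'g : cut 1 1 g' g = id1.
  by apply: (epi E); rewrite ?icut11 ?ocut11 // A11 // -eg' -eg unit_r.
have [f [if_ of_ ef]] := lift _ ig og.
have [f' [if' of' ef']] := lift _ ig' og'.
(* The lift of a composite is the composite of the lifts, by [mono]. *)
have lift_inv h h' m m' : inp h = [:: a] -> out h = [:: a] ->
    inp h' = [:: a] -> out h' = [:: a] -> inp m = [:: a] -> out m = [:: a] ->
    inp m' = [:: a] -> cut 1 k h w = cut 1 1 w m ->
    cut 1 k h' w = cut 1 1 w m' -> cut 1 1 m m' = id1 -> cut 1 1 h h' = id1.
  move=> ih oh ih' oh' im om im' eh eh' mm'.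
  apply: mono; rewrite ?icut11 ?ocut11 //.
  by rewrite -slide2 // eh' slide // eh -A11 // mm' unit_r ?unit_k.
have inv : inverse_cells a f f'.
  split=> //; rewrite (lift_inv f f' g g') // (lift_inv f' f g' g) //.
have iwf : inp (cut 1 1 w f) = G1 ++ a :: G2.
  by rewrite (inp_cut1 (G1:=[::]) ow if_) //= cats0.
have owf : out (cut 1 1 w f) = [:: a] by rewrite (out_cut1 (G1:=[::]) ow if_).
exists (cut 1 1 w f); split; rewrite ?iwf //.
  split; last exact: universal_inp1_cut_inverse iw ow ek vw inv.
  exact: (universal_out1_cut (H1:=[::])) uw ow (inverse_cells_out1 inv) of_ if_ _.
have -> : cut 1 k (cut 1 1 w f) (cut 1 1 w f) = cut 1 1 E f.
  transitivity (cut 1 1 (cut 1 k (cut 1 1 w f) w) f).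
    by apply: (cutA (D1:=[::]) (K1:=[::]) (H1:=[::]) owf iw ow if_) => //; solve_planar.
  congr (cut 1 1 _ f); transitivity (cut 1 k w (cut 1 k f w)).
    symmetry; apply: (cutA (D1:=[::]) (G1:=[::]) (K1:=[::]) ow if_ of_ iw) => //;
      rewrite ?cats0 //; solve_planar.
  rewrite ef eg.
  by apply: (cutA (D1:=[::]) (K1:=[::]) (H1:=[::]) ow iw ow ig) => //; solve_planar.
symmetry.
by apply: (cutA (D1:=[::]) (K1:=[::]) (H1:=[::]) oe iwu ow if_) => //; solve_planar.
Qed.

Lemma associative_left_witness (hX : unital X) a u l e :
  left_witness u a l -> inp e = [:: u; u] -> out e = [:: u] -> universal_out 1 e ->
  exists l', left_witness u a l' /\ cut 1 2 l' l' = cut 1 1 e l'.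
Proof.
move=> [il ol ul vl] ie oe ue.
have [//|l' [il' ol' [ul' vl'] el']] := associative_witness (G1:=[:: u]) (H1:=[::])
  hX il il ol erefl erefl ul vl ie oe ue.
by exists l'; split=> //; split=> //; rewrite il'.
Qed.

Lemma associative_right_witness (hX : unital X) a u r e :
  right_witness u a r -> inp e = [:: u; u] -> out e = [:: u] -> universal_out 1 e ->
  exists r', right_witness u a r' /\ cut 1 1 r' r' = cut 1 2 e r'.
Proof.
move=> [ir or_ ur vr] ie oe ue.
have [//|r' [ir' or' [ur' vr'] er']] := associative_witness (G1:=[::]) (H1:=[:: a])
  hX ir ir or_ erefl erefl ur vr ie oe ue.
by exists r'; split=> //; split=> //; rewrite ir'.
Qed.

(** * Naturality *)

(** The planarity condition on [H1] and [H2] says that [a] is the extremal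
    input of [p] on the side where the unit of [wa] sits, so the unit ends up in
    the same place in [cut j k p wb] and in [cut 1 i wa p].  In the last
    hypothesis the unit is doubled on both sides of an equation; it holds as
    soon as doubling a unit amounts to plugging a multiplication into it. *)
Lemma natural_witness a b G1 G2 H1 H2 D1 D2 j k k2 i wa wb p :
  inp wa = G1 ++ a :: G2 -> out wa = [:: a] -> universal_out 1 wa ->
  inp wb = G1 ++ b :: G2 -> out wb = [:: b] -> universal_inp k wb ->
  inp p = H1 ++ a :: H2 -> out p = D1 ++ b :: D2 ->
  planar G1 G2 D1 D2 -> planar G1 G2 H1 H2 ->
  j = (size D1).+1 -> k = (size G1).+1 -> i = (size H1).+1 ->
  k2 = (size (G1 ++ G1)).+1 ->
  (forall s, inp s = inp p -> out s = out p ->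
     cut j k p wb = cut 1 i wa s ->
     cut j k2 p (cut 1 k wb wb) = cut 1 i (cut 1 k wa wa) s) ->
  cut j k p wb = cut 1 i wa p.
Proof.
move=> iwa owa ua iwb owb ub ip op plD plH ej ek ei ek2 dbl.
have catGH : G1 ++ H1 = H1 ++ G1 by case: plH => [[]-> _]; rewrite ?cats0.
have catHG : H2 ++ G2 = G2 ++ H2 by case: plH => [_ []->]; rewrite ?cats0.
have ipb : inp (cut j k p wb) = G1 ++ inp p ++ G2 by rewrite (inp_cut op iwb).
have opb : out (cut j k p wb) = D1 ++ b :: D2 by rewrite (out_cut op iwb) // owb.
have iap : inp (cut 1 i wa p) = G1 ++ inp p ++ G2.
  by rewrite (inp_cut1 owa ip) // iwa ip -!catA /= catHG !catA catGH.
have oap : out (cut 1 i wa p) = D1 ++ b :: D2 by rewrite (out_cut1 owa ip).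
have [|s [is_ os es]] :=
    universal_out1_ex (G1:=H1) (G2:=H2) (s:=cut j k p wb) ua owa _ ei.
  by rewrite ipb -iap (inp_cut1 owa ip).
apply: (universal_inp1_inj ub iwb owb ek plD _ opb oap ej).
  by rewrite ipb iap.
(* Both sides, once cut with [wb], are the doubled composite. *)
transitivity (cut j k2 p (cut 1 k wb wb)).
  symmetry; apply: (cutA (K1:=[::]) op iwb owb iwb) => //; rewrite ?cats0 //.
rewrite (dbl s) ?is_ ?os //; last by rewrite opb.
transitivity (cut 1 (size (H1 ++ G1)).+1 wa (cut 1 i wa s)).
  symmetry; apply: (cutA (D1:=[::]) (K1:=[::]) owa iwa owa is_) => //; solve_planar.
rewrite -es -catGH.
by apply: (cutA (D1:=[::]) owa ip op iwb) => //; rewrite ?cats0 //; solve_planar.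
Qed.

(** * Compatibility of the two actions between adjacent inputs *)

(** All terms of the calculation are equal to [q(r(a, e(u, v)), b)]: the unit in
    [q(r(a, u), b)] may be doubled on its left, through the action law of [r],
    or on its right, through that of [l], since that composite also factors
    through [l].  Cancelling the inner [r] leaves the equation. *)
Lemma triangle a b u G1 G2 j r l e q :
  inp r = [:: a; u] -> out r = [:: a] -> universal_out 1 r ->
  inp l = [:: u; b] -> out l = [:: b] -> universal_out 1 l ->
  inp e = [:: u; u] -> out e = [:: u] ->
  cut 1 1 r r = cut 1 2 e r -> cut 1 2 l l = cut 1 1 e l ->
  inp q = G1 ++ a :: b :: G2 -> j = (size G1).+1 ->
  cut 1 j r q = cut 1 j.+1 l q.
Proof.
move=> ir or_ ur il ol ul ie oe rr ll iq ej.
have iq' : inp q = (G1 ++ [:: a]) ++ b :: G2 by rewrite iq -catA.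
have ej' : j.+1 = (size (G1 ++ [:: a])).+1 by rewrite size_cat addn1 ej.
have irq : inp (cut 1 j r q) = G1 ++ a :: u :: b :: G2.
  by rewrite (inp_cut1 or_ iq) // ir.
have ilq : inp (cut 1 j.+1 l q) = G1 ++ a :: u :: b :: G2.
  by rewrite (inp_cut1 ol iq') // il -catA.
have [||T [iT oT eT]] := universal_out1_ex (G1:=G1 ++ [:: a]) (G2:=G2)
    (i:=j.+1) (s:=cut 1 j r q) ul ol => //.
  by rewrite irq il -catA.
have iT' : inp T = G1 ++ a :: b :: G2 by rewrite iT -catA.
apply: (universal_out1_inj ur or_ irq ilq _ ej).
  by rewrite (out_cut1 or_ iq) // (out_cut1 ol iq').
transitivity (cut 1 j.+1 e (cut 1 j r q)).
  transitivity (cut 1 j (cut 1 1 r r) q).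
    apply: (cutA (D1:=[::]) (G1:=[::]) (K1:=[::]) or_ ir or_ iq) => //;
      rewrite ?cats0 //; solve_planar.
  rewrite rr; symmetry.
  apply: (cutA (D1:=[::]) (G1:=[:: a]) (K1:=[::]) oe ir or_ iq) => //; solve_planar.
transitivity (cut 1 j.+2 l (cut 1 j r q)).
  rewrite eT.
  transitivity (cut 1 j.+1 (cut 1 1 e l) T).
    apply: (cutA (D1:=[::]) (G1:=[::]) (K1:=[::]) oe il ol iT) => //;
      rewrite ?cats0 //; solve_planar.
  rewrite -ll; symmetry.
  apply: (cutA (D1:=[::]) (G1:=[:: u]) (K1:=[::]) ol il ol iT) => //; try solve_planar.
  by rewrite !size_cat ej /=; lia.
symmetry.
apply: (cutC (A1:=[::]) (B1:=[::]) (G2:=[::]) or_ ol iq) => //; try solve_planar.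
by rewrite ir !size_cat ej /=; lia.
Qed.

Lemma left_natural a b u l_a l_b e p H D :
  left_witness u a l_a -> left_witness u b l_b ->
  inp e = [:: u; u] -> out e = [:: u] ->
  cut 1 2 l_a l_a = cut 1 1 e l_a -> cut 1 2 l_b l_b = cut 1 1 e l_b ->
  inp p = a :: H -> out p = b :: D -> cut 1 2 p l_b = cut 1 1 l_a p.
Proof.
move=> [ia oa ua va] [ib ob ub vb] ie oe ea eb ip op.
apply: (natural_witness (G1:=[:: u]) (H1:=[::]) (D1:=[::]) (k2:=3)
  ia oa ua ib ob vb ip op) => //; try solve_planar.
move=> s is_ os es; rewrite ea eb.
transitivity (cut 1 1 e (cut 1 2 p l_b)).
  by symmetry; apply: (cutC (A1:=[::]) (B1:=[::]) (G1:=[::]) (G2:=[::]) oe op ib);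
    rewrite ?ie //; solve_planar.
rewrite es ip in is_ *.
by apply: (cutA (D1:=[::]) (G1:=[::]) (K1:=[::]) (H1:=[::]) oe ia oa is_) => //;
   solve_planar.
Qed.

Lemma right_natural a b u r_a r_b e p H D :
  right_witness u a r_a -> right_witness u b r_b ->
  inp e = [:: u; u] -> out e = [:: u] ->
  cut 1 1 r_a r_a = cut 1 2 e r_a -> cut 1 1 r_b r_b = cut 1 2 e r_b ->
  inp p = H ++ [:: a] -> out p = D ++ [:: b] ->
  cut (size (out p)) 1 p r_b = cut 1 (size (inp p)) r_a p.
Proof.
move=> [ia oa ua va] [ib ob ub vb] ie oe ea eb ip op.
have so : size (out p) = (size D).+1 by rewrite op size_cat addn1.
have si : size (inp p) = (size H).+1 by rewrite ip size_cat addn1.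
apply: (natural_witness (G1:=[::]) (k2:=1) ia oa ua ib ob vb ip op) => //;
  try solve_planar.
move=> s is_ os es; rewrite ea eb.
transitivity (cut 1 (size (inp p)).+1 e (cut (size (out p)) 1 p r_b)).
  by apply: (cutC (B1:=[::]) (G1:=[::]) (G2:=[::]) op oe ib);
    rewrite ?cats0 //; solve_planar.
rewrite es {1}ip in is_ *.
apply: (cutA (D1:=[::]) (G1:=[:: a]) (K1:=[::]) oe ia oa is_) => //; try solve_planar.
by rewrite si size_cat addn1.
Qed.

(** * Boundaries of adjacent 1-cells *)

Lemma is_path_cat (x y : cell0 X) (s1 s2 : seq (cell1 X)) :
  is_path (@src X) (@tgt X) x (s1 ++ s2) y ->
  exists2 z, is_path (@src X) (@tgt X) x s1 z & is_path (@src X) (@tgt X) z s2 y.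
Proof.
elim: s1 x => [|c s1 IH] x /=; first by exists x.
by move=> [sc /IH[z pz ps]]; exists z.
Qed.

Lemma path_endpoints q a b G1 G2 : inp q = G1 ++ a :: b :: G2 -> src b = tgt a.
Proof.
move=> iq; have [x [y [+ _]]] := boundaryP q.
by rewrite iq => /is_path_cat[z _ [_ [-> _]]].
Qed.

Lemma path_src p a b H D : inp p = a :: H -> out p = b :: D -> src a = src b.
Proof.
by move=> ip op; have [x [y [+ +]]] := boundaryP p; rewrite ip op => -[-> _] [].
Qed.

Lemma path_tgt p a b H D :
  inp p = H ++ [:: a] -> out p = D ++ [:: b] -> tgt a = tgt b.
Proof.
move=> ip op; have [x [y [+ +]]] := boundaryP p; rewrite ip op.
by move=> /is_path_cat[? _ [_ ->]] /is_path_cat[? _ [_ ->]].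
Qed.

End Cuts.

Theorem theorem4p1 (X : polybicat) (hX : tensor_0_representable X)
    (one : cell0 X -> cell1 X) (hone : forall x : cell0 X, tensor_unit x (one x)) :
  exists l r : cell1 X -> cell2 X,
    (forall a : cell1 X, left_witness (one (src a)) a (l a)) /\
    (forall a : cell1 X, right_witness (one (tgt a)) a (r a)) /\
    (forall (p : cell2 X) (a b : cell1 X) (G D : seq (cell1 X)),
       inp p = a :: G -> out p = b :: D ->
       cut 1 2 p (l b) = cut 1 1 (l a) p) /\
    (forall (p : cell2 X) (a b : cell1 X) (G D : seq (cell1 X)),
       inp p = G ++ [:: a] -> out p = D ++ [:: b] ->
       cut (size (out p)) 1 p (r b) = cut 1 (size (inp p)) (r a) p) /\
    (forall (q : cell2 X) (a b : cell1 X) (G1 G2 : seq (cell1 X)) (j : nat),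
       inp q = G1 ++ a :: b :: G2 -> j = (size G1).+1 ->
       cut 1 j (r a) q = cut 1 j.+1 (l b) q).
Proof.
have [un _] := hX.
(* One multiplication per unit serves both [l] and [r]: this is what links
   them in the last equation.  Any left witness on the unit itself will do. *)
have /functional_choice[e eP] : forall x, exists e : cell2 X,
    [/\ inp e = [:: one x; one x], out e = [:: one x] & universal_out 1 e].
  by move=> x; have [s1 _ /(_ _ s1)[l [il ol ul _]] _] := hone x; exists l.
have /functional_choice[l lP] : forall a, exists l : cell2 X,
    left_witness (one (src a)) a l /\ cut 1 2 l l = cut 1 1 (e (src a)) l.
  move=> a; have [_ _ /(_ a erefl)[l lw] _] := hone (src a).
  by have [ie oe ue] := eP (src a); apply: associative_left_witness lw ie oe ue.
have /functional_choice[r rP] : forall a, exists r : cell2 X,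
    right_witness (one (tgt a)) a r /\ cut 1 1 r r = cut 1 2 (e (tgt a)) r.
  move=> a; have [_ _ _ /(_ a erefl)[r rw]] := hone (tgt a).
  by have [ie oe ue] := eP (tgt a); apply: associative_right_witness rw ie oe ue.
exists l, r; split; first by move=> a; have [] := lP a.
split; first by move=> a; have [] := rP a.
split=> [p a b G D ip op|].
  have [la ea] := lP a; have [lb eb] := lP b; have [ie oe _] := eP (src b).
  rewrite (path_src ip op) in la ea.
  exact: left_natural la lb ie oe ea eb ip op.
split=> [p a b G D ip op|q a b G1 G2 j iq ej].
  have [ra ea] := rP a; have [rb eb] := rP b; have [ie oe _] := eP (tgt b).
  rewrite (path_tgt ip op) in ra ea.
  exact: right_natural ra rb ie oe ea eb ip op.
have [[ir or_ ur _] er] := rP a; have [[il ol ul _] el] := lP b.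
have [ie oe _] := eP (tgt a).
rewrite (path_endpoints iq) in il el.
exact: triangle ir or_ ur il ol ul ie oe er el iq ej.
Qed.
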